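(* When $p<q$ are integers, the $(p,q)$-biased Star (maximum degree) game and the $(p,q)$-biased vertex-capturing game on $K_n$ are both player $2$ wins provided that $n$ is sufficiently large.
   Context: Two players, Alice (player 1, starting) and Bob (player 2), alternately colour uncoloured edges of the complete graph $K_n$, Alice in red and Bob in blue; in the $(p,q)$-biased version Alice colours $p$ edges per turn and Bob $q$ edges per turn. In the Star game, Alice's score is $a=\Delta(G[A])$ and Bob's is $b=\Delta(G[B])$, the maximum degrees of the red and blue graphs. In the vertex-capturing game, $a$ is the number of vertices for which most incident edges are red and $b$ the number of vertices for which most incident edges are blue. When $q>p$, Bob (player 2) wins if at the end $b>a$. *)

(* Defs.v *)
From mathcomp Require Import all_boot.

Set Implicit Arguments.
Unset Strict Implicit.
Unset Printing Implicit Defensive.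

(* A graph on 'I_n is its set of edges, an edge being a two-element set. *)
Definition graph (n : nat) : Type := {set {set 'I_n}}.

Definition complete_graph (n : nat) : graph n := [set e : {set 'I_n} | #|e| == 2].

Definition degree (n : nat) (G : graph n) (v : 'I_n) : nat :=
  #|[set e in G | v \in e]|.

Definition max_degree (n : nat) (G : graph n) : nat := \max_(v < n) degree G v.

(* "Most" means strictly more than half of the edges of K_n at v. *)
Definition captured (n : nat) (G : graph n) : nat :=
  #|[set v : 'I_n | degree (complete_graph n) v < (degree G v).*2]|.

(* A history lists, turn by turn, the set of edges coloured in that turn; turns
   are numbered from 0, so Alice plays the even ones and Bob the odd ones. *)
Definition history (n : nat) : Type := seq (graph n).

Definition red (n : nat) (h : history n) : graph n :=
  \bigcup_(i < size h | ~~ odd i) nth set0 h i.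

Definition blue (n : nat) (h : history n) : graph n :=
  \bigcup_(i < size h | odd i) nth set0 h i.

Definition uncoloured (n : nat) (h : history n) : graph n :=
  complete_graph n :\: (red h :|: blue h).

(* The game stops once every edge is coloured.  A player facing fewer uncoloured
   edges than his bias colours all of them. *)
Definition legal_move (p q n : nat) (h : history n) (M : graph n) : Prop :=
  [/\ uncoloured h != set0, M \subset uncoloured h &
      #|M| = minn (if odd (size h) then q else p) #|uncoloured h|].

Definition legal_play (p q n : nat) (h : history n) : Prop :=
  forall i : nat, i < size h -> legal_move p q (take i h) (nth set0 h i).

Definition legal_strategy2 (p q n : nat) (s : history n -> graph n) : Prop :=
  forall h : history n, legal_play p q h -> odd (size h) ->
    uncoloured h != set0 -> legal_move p q h (s h).

Definition follows2 (n : nat) (s : history n -> graph n) (h : history n) : Prop :=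
  forall i : nat, i < size h -> odd i -> nth set0 h i = s (take i h).

Definition player2_wins (p q n : nat) (score : graph n -> nat) : Prop :=
  exists s : history n -> graph n,
    legal_strategy2 p q s /\
    forall h : history n, legal_play p q h -> follows2 s h ->
      uncoloured h = set0 -> score (red h) < score (blue h).

(* Main.v *)
(* Bob gives each vertex v the weight (1 + a)^red(v) * (1 - b)^blue(v), gives each
   edge the sum of the weights of its ends, and always colours the q heaviest
   uncoloured edges.  Every edge that Alice colours next is at most as heavy as
   each of these, so for small a and suitable b < a the total weight never
   increases over a round and stays below n (1 + a)^p.  If moreover
   g = (1 + a)(1 - b) > 1, a vertex ending with red(v) >= blue(v) would have weight
   at least g^((n - 1) / 2), which is impossible for large n.  Hence at the end
   blue exceeds red at every vertex, which settles both games at once. *)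
Require Import Defs.
From mathcomp Require Import all_boot all_order all_algebra.
From mathcomp Require Import zify ring lra.

Set Implicit Arguments.
Unset Strict Implicit.
Unset Printing Implicit Defensive.

Import Order.TTheory GRing.Theory Num.Theory.

(** * Degrees in unions and in the complete graph *)

Lemma degreeU n (A B : graph n) v :
  [disjoint A & B] -> degree (A :|: B) v = degree A v + degree B v.
Proof.
move=> dAB; rewrite /degree !setIdE setIUl cardsU.
set S := [set _ | _].
suff /eqP-> : A :&: S :&: (B :&: S) == set0.
  by rewrite cards0 subn0.
rewrite setI_eq0.
by apply: disjointWl (subsetIl _ _) _; apply: disjointWr (subsetIl _ _) _.
Qed.

Lemma degree_le_card n (A : graph n) v : degree A v <= #|A|.
Proof. by rewrite /degree setIdE subset_leq_card ?subsetIl. Qed.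

Lemma degree0 n (v : 'I_n) : degree set0 v = 0.
Proof. by apply/eqP; rewrite -leqn0 -(cards0 {set 'I_n}) degree_le_card. Qed.

Lemma degree_complete_ge n (v : 'I_n) : n.-1 <= degree (complete_graph n) v.
Proof.
have <- : #|[set~ v]| = n.-1 by rewrite cardsC1 card_ord.
have inj : {in [set~ v] &, injective (fun u => [set v; u])}.
  move=> u u'; rewrite !inE => nu nu' /setP/(_ u).
  by rewrite !inE eqxx orbT (negPf nu) => /esym/eqP.
rewrite -(card_in_imset inj).
apply/subset_leq_card/subsetP => _ /imsetP[u + ->]; rewrite !inE => nu.
by rewrite cards2 eqxx (eq_sym v) nu.
Qed.

(** * Colour classes along a history *)

Lemma history_unions_rcons n (h : history n) M :
  (red (rcons h M) = if odd (size h) then red h else red h :|: M) *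
  (blue (rcons h M) = if odd (size h) then blue h :|: M else blue h).
Proof.
by split; rewrite /red /blue size_rcons big_mkcond big_ord_recr /= nth_rcons ltnn
  eqxx [in RHS]big_mkcond /=; case: odd; rewrite /= ?setU0; 
  [|congr (_ :|: _)|congr (_ :|: _)|]; apply: eq_bigr => i _;
  rewrite nth_rcons ltn_ord.
Qed.

Lemma uncoloured_rcons n (h : history n) M :
  uncoloured (rcons h M) = uncoloured h :\: M.
Proof.
rewrite /uncoloured setDDl !history_unions_rcons; case: odd; rewrite ?setUA //.
by rewrite setUAC.
Qed.

Lemma legal_play_rcons p q n (h : history n) M :
  legal_play p q (rcons h M) -> legal_play p q h /\ legal_move p q h M.
Proof.
move=> hl; split=> [i lti|].
  have:= hl i; rewrite size_rcons nth_rcons lti -cats1 takel_cat ?(ltnW lti) //.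
  by apply; rewrite ltnW.
have:= hl (size h); rewrite size_rcons nth_rcons ltnn eqxx -cats1 take_size_cat //.
exact.
Qed.

Lemma follows2_rcons n (s : history n -> graph n) (h : history n) M :
  follows2 s (rcons h M) -> follows2 s h /\ (odd (size h) -> M = s h).
Proof.
move=> hf; split=> [i lti oi|oh].
  have:= hf i; rewrite size_rcons nth_rcons lti -cats1 takel_cat ?(ltnW lti) //.
  by apply; rewrite // ltnW.
have:= hf (size h); rewrite size_rcons nth_rcons ltnn eqxx -cats1 take_size_cat //.
exact.
Qed.

Lemma red_blue_disjoint p q n (h : history n) :
  legal_play p q h -> [disjoint red h & blue h].
Proof.
elim/last_ind: h => [_|h M IH /legal_play_rcons[/IH dh [_ sM _]]].
  by rewrite /red big_ord0 disjoint_sym -setI_eq0 setI0.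
have {sM} : M :&: (red h :|: blue h) == set0.
  by move: sM; rewrite /uncoloured setDE subsetI -disjoints_subset setI_eq0 => /andP[].
move: dh; rewrite !history_unions_rcons -!setI_eq0 setIUr setU_eq0 => dh /andP[r0 b0].
by case: odd; rewrite ?setIUr ?setIUl setU_eq0 dh // setIC.
Qed.

Lemma red_blue_subset p q n (h : history n) :
  legal_play p q h -> red h :|: blue h \subset complete_graph n.
Proof.
elim/last_ind: h => [_|h M IH /legal_play_rcons[/IH dh [_ sM _]]].
  by rewrite /red /blue !big_ord0 setU0 sub0set.
have {}sM : M \subset complete_graph n by apply: subset_trans sM (subsetDl _ _).
rewrite !history_unions_rcons; case: odd.
  by rewrite setUA subUset dh.
by rewrite setUAC subUset dh.
Qed.

Lemma degree_final p q n (h : history n) v :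
  legal_play p q h -> uncoloured h = set0 ->
  degree (complete_graph n) v = degree (red h) v + degree (blue h) v.
Proof.
move=> lh /eqP; rewrite setD_eq0 => sub.
have -> : complete_graph n = red h :|: blue h.
  by apply/eqP; rewrite eqEsubset sub (red_blue_subset lh).
exact: degreeU (red_blue_disjoint lh).
Qed.

(** * From a comparison at every vertex to the two scores *)

Lemma max_degree_lt n (A B : graph n) : 0 < n ->
  (forall v, degree A v < degree B v) -> max_degree A < max_degree B.
Proof.
case: n A B => // n A B _ lt.
have [v vA] : {v | max_degree A = degree A v}.
  by apply: bigop.eq_bigmax; rewrite card_ord.
rewrite vA.
by apply: leq_trans (lt v) _; apply: leq_bigmax.
Qed.

(** When every edge is coloured, a strict lead at a vertex is already a majority there, so blue
    takes all [n] vertices and red takes none. *)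
Lemma captured_lt n (A B : graph n) : 0 < n ->
  (forall v, degree A v < degree B v) ->
  (forall v, degree (complete_graph n) v = degree A v + degree B v) ->
  captured A < captured B.
Proof.
move=> n0 lt eK; rewrite /captured.
have -> : [set v | degree (complete_graph n) v < (degree A v).*2] = set0.
  by apply/setP => v; rewrite !inE eK; have:= lt v; lia.
have -> : [set v | degree (complete_graph n) v < (degree B v).*2] = setT.
  by apply/setP => v; rewrite !inE eK; have:= lt v; lia.
by rewrite cards0 cardsT card_ord.
Qed.

Local Open Scope ring_scope.

Section Potential.

Variable R : realFieldType.

(** * Linear bounds for powers *)

Lemma bernoulli_ge (x : R) n : -1 <= x -> 1 + n%:R * x <= (1 + x) ^+ n.
Proof.
move=> x1; elim: n => [|n IH]; first by rewrite expr0 mul0r addr0.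
rewrite exprS; apply: le_trans (ler_wpM2l _ IH); last by lra.
have: 0 <= n%:R * x ^+ 2 by rewrite mulr_ge0 ?ler0n ?sqr_ge0.
by rewrite -natr1; nra.
Qed.

(** Each further factor adds at most the increment [a * (1 + a) ^+ m]. Having one slope for all
    [d <= m] makes the bound linear in a degree, so that it can be summed edge by edge. *)
Lemma expr_growth_le (a : R) d m : 0 <= a -> (d <= m)%N ->
  (1 + a) ^+ d <= 1 + d%:R * (a * (1 + a) ^+ m).
Proof.
move=> a0; elim: d => [_|d IH ltm]; first by rewrite expr0 mul0r addr0.
have:= IH (ltnW ltm).
have: (1 + a) ^+ d <= (1 + a) ^+ m by apply: ler_weXn2l; [lra|exact: ltnW].
by rewrite exprS -natr1; nra.
Qed.

Lemma expr_decay_le (b : R) d m : 0 <= b <= 1 -> (d <= m)%N ->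
  (1 - b) ^+ d <= 1 - d%:R * (b * (1 - b) ^+ m).
Proof.
move=> b01; elim: d => [_|d IH ltm]; first by rewrite expr0 mul0r subr0.
have:= IH (ltnW ltm).
have: (1 - b) ^+ m <= (1 - b) ^+ d by apply: ler_wiXn2l; [lra|lra|exact: ltnW].
by rewrite exprS -natr1; nra.
Qed.

(** * Weights, potential and heaviest edges *)

Definition vertex_weight (a b : R) n (A B : graph n) (v : 'I_n) : R :=
  (1 + a) ^+ degree A v * (1 - b) ^+ degree B v.

Definition potential (a b : R) n (A B : graph n) : R :=
  \sum_v vertex_weight a b A B v.

Definition edge_weight (a b : R) n (A B : graph n) (e : {set 'I_n}) : R :=
  \sum_(v in e) vertex_weight a b A B v.

(** The reversed comparison sorts by decreasing weight. If fewer than [q] elements remain, [take]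
    keeps them all, as the rules demand of a last move. *)
Definition heaviest (T : finType) (w : T -> R) (U : {set T}) (q : nat) : {set T} :=
  [set x in take q (sort (fun x y => w y <= w x) (enum U))].

Lemma heaviest_sub (T : finType) (w : T -> R) U q : heaviest w U q \subset U.
Proof. by apply/subsetP => x; rewrite inE => /mem_take; rewrite mem_sort mem_enum. Qed.

Lemma card_heaviest (T : finType) (w : T -> R) U q :
  #|heaviest w U q| = minn q #|U|.
Proof.
rewrite cardsE; set s := sort _ _.
have us : uniq s by rewrite sort_uniq enum_uniq.
by rewrite (card_uniqP (take_uniq _ us)) size_take_min size_sort -cardE.
Qed.

Lemma heaviestP (T : finType) (w : T -> R) U q x y :
  x \in heaviest w U q -> y \in U :\: heaviest w U q -> w y <= w x.
Proof.
rewrite !inE; set s := sort _ _ => xs /andP[yns yU].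
have ys : y \in drop q s.
  have: y \in s by rewrite mem_sort mem_enum.
  by rewrite -[in X in X -> _](cat_take_drop q s) mem_cat (negPf yns).
have: sorted (fun x y => w y <= w x) s by apply: sort_sorted => u v; exact: le_total.
rewrite sorted_pairwise; last by move=> u v t /[swap]; exact: le_trans.
by rewrite -(cat_take_drop q s) pairwise_cat => /andP[/allrelP/(_ _ _ xs ys)].
Qed.

(** Double counting of incidences: it turns a change that is linear in the degrees into a sum of
    edge weights. *)
Lemma sum_degree n (w : 'I_n -> R) (F : graph n) :
  \sum_v w v * (degree F v)%:R = \sum_(e in F) \sum_(v in e) w v.
Proof.
rewrite (exchange_big_dep predT) //=; apply: eq_bigr => v _.
rewrite /degree sumr_const -[RHS]mulr_natr; congr (_ * _).
congr _%:R; by apply: eq_card => e; rewrite !inE.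
Qed.

(** Both sides are sums over the pairs in [Q] times [F], compared term by term. *)
Lemma sum_dominated (T : finType) (w : T -> R) (Q F : {set T}) :
  (forall e f, e \in Q -> f \in F -> w f <= w e) ->
  #|Q|%:R * \sum_(f in F) w f <= #|F|%:R * \sum_(e in Q) w e.
Proof.
move=> dom.
have -> : #|Q|%:R * \sum_(f in F) w f = \sum_(e in Q) \sum_(f in F) w f.
  by rewrite sumr_const mulr_natl.
have -> : #|F|%:R * \sum_(e in Q) w e = \sum_(e in Q) \sum_(f in F) w e.
  by rewrite mulr_sumr; apply: eq_bigr => e _; rewrite sumr_const mulr_natl.
by apply: ler_sum => e eQ; apply: ler_sum => f; apply: dom.
Qed.

(** * The potential during play *)

Section Weights.

Variables (p q : nat) (a b : R).
Hypotheses (a0 : 0 <= a) (b0 : 0 <= b) (b1 : b <= 1).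

Let growth_ge0 : 0 <= 1 + a. Proof. by rewrite addr_ge0. Qed.
Let decay_ge0 : 0 <= 1 - b. Proof. by rewrite subr_ge0. Qed.

Lemma vertex_weight_ge0 n (A B : graph n) v : 0 <= vertex_weight a b A B v.
Proof. by rewrite !mulr_ge0 ?exprn_ge0. Qed.

Lemma edge_weight_ge0 n (A B : graph n) e : 0 <= edge_weight a b A B e.
Proof. by apply: sumr_ge0 => v _; apply: vertex_weight_ge0. Qed.

(** At each vertex the two powers are replaced by their linear bounds; the cross term is dropped
    because the decay factor is at most 1. *)
Lemma potential_step n (A B Q F : graph n) :
  [disjoint A & F] -> [disjoint B & Q] -> (#|Q| <= q)%N -> (#|F| <= p)%N ->
  potential a b (A :|: F) (B :|: Q) <= potential a b A B
    - b * (1 - b) ^+ q * \sum_(e in Q) edge_weight a b A B e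
    + a * (1 + a) ^+ p * \sum_(f in F) edge_weight a b A B f.
Proof.
move=> dAF dBQ cQ cF; rewrite /edge_weight -!sum_degree !mulr_sumr -sumrB -big_split.
apply: ler_sum => v _ /=; rewrite {1}/vertex_weight !degreeU // !exprD.
have w0 := vertex_weight_ge0 A B v.
have F1 := expr_growth_le a0 (leq_trans (degree_le_card F v) cF).
have Q1 : (1 - b) ^+ degree Q v <= 1 - (degree Q v)%:R * (b * (1 - b) ^+ q).
  by apply: expr_decay_le (leq_trans (degree_le_card Q v) cQ); rewrite b0.
have Q2 : (1 - b) ^+ degree Q v <= 1 by rewrite exprn_ile1 // gerBl.
have Q3 : 0 <= (1 - b) ^+ degree Q v by rewrite exprn_ge0.
have G0 : 0 <= (degree F v)%:R * (a * (1 + a) ^+ p).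
  by rewrite !mulr_ge0 ?ler0n ?exprn_ge0 // addr_ge0.
have factor (w s t x y : R) : w - s * (w * x) + t * (w * y) = w * (1 - x * s + y * t).
  by ring.
have prod_le (x y X Y : R) : 0 <= x -> x <= 1 -> x <= 1 - X -> y <= 1 + Y ->
  0 <= Y -> y * x <= 1 - X + Y.
  move=> x0 x1 xX yY Y0; apply: le_trans (ler_wpM2r x0 yY) _.
  by rewrite mulrDl mul1r lerD // ler_piMr.
by rewrite mulrACA factor; apply: ler_wpM2l => //; apply: prod_le.
Qed.

Hypothesis q0 : (0 < q)%N.
Hypothesis balance : p%:R * (a * (1 + a) ^+ p) <= q%:R * (b * (1 - b) ^+ q).

(** A round is Bob's move followed by Alice's reply, so that [F] is chosen among edges no heavier
    than those of [Q]. The gain from [F] is then paid for by the loss from [Q], through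
    [balance]. *)
Lemma potential_round n (A B U F : graph n) :
  let Q := heaviest (edge_weight a b A B) U q in
  [disjoint A & U] -> [disjoint B & U] ->
  F \subset U :\: Q -> (#|F| <= p)%N ->
  potential a b (A :|: F) (B :|: Q) <= potential a b A B.
Proof.
move=> Q dA dB sF cF.
have sQ : Q \subset U := heaviest_sub _ _ _.
have dAF : [disjoint A & F].
  by apply: disjointWr dA; apply: subset_trans sF (subsetDl _ _).
have dBQ : [disjoint B & Q] by apply: disjointWr dB.
have cQ : #|Q| = minn q #|U| := card_heaviest _ _ _.
have cQq : (#|Q| <= q)%N by rewrite cQ geq_minl.
apply: le_trans (potential_step dAF dBQ cQq cF) _.
set SQ := \sum_(e in Q) _; set SF := \sum_(f in F) _.
have SQ0 : 0 <= SQ by apply: sumr_ge0 => e _; apply: edge_weight_ge0.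
have SF0 : 0 <= SF by apply: sumr_ge0 => e _; apply: edge_weight_ge0.
have bq0 : 0 <= b * (1 - b) ^+ q by rewrite !mulr_ge0 ?exprn_ge0.
have ap0 : 0 <= a * (1 + a) ^+ p by rewrite !mulr_ge0 ?exprn_ge0.
have [F0|[f fF]] := set_0Vmem F.
  by rewrite /SF F0 big_set0 mulr0 addr0 gerBl mulr_ge0.
have ltU : (#|Q| < #|U|)%N.
  apply/proper_card/properP; split=> //; exists f.
    by have /setDP[] := subsetP sF _ fF.
  by have /setDP[] := subsetP sF _ fF.
(* An edge left for Alice shows that Bob did not run out of edges, so he coloured exactly [q]. *)
have eQ : #|Q| = q.
  rewrite cQ; apply/minn_idPl; apply: contraTT ltU; rewrite -ltnNge cQ.
  by move=> /ltnW/minn_idPr->; rewrite ltnn.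
have dom : q%:R * SF <= p%:R * SQ.
  apply: (@le_trans _ _ (#|F|%:R * SQ)); last by rewrite ler_wpM2r ?ler_nat.
  rewrite -eQ; apply: sum_dominated => e g eQ' gF.
  by apply: heaviestP eQ' _; exact: subsetP sF _ gF.
have qgt0 : 0 < q%:R :> R by rewrite ltr0n.
have key : q%:R * (a * (1 + a) ^+ p * SF) <= q%:R * (b * (1 - b) ^+ q * SQ).
  rewrite [leLHS]mulrCA; apply: le_trans (ler_wpM2l ap0 dom) _.
  by rewrite [leLHS]mulrCA [leLHS]mulrA [leRHS]mulrA ler_wpM2r.
by move: key; rewrite ler_pM2l // -addrA gerDl addrC subr_le0.
Qed.

Definition heaviest_strategy n (h : history n) : graph n :=
  heaviest (edge_weight a b (red h) (blue h)) (uncoloured h) q.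

Lemma heaviest_strategy_legal n : legal_strategy2 p q (@heaviest_strategy n).
Proof. by move=> h _ oh nz; split; rewrite ?heaviest_sub // card_heaviest oh. Qed.

Lemma uncoloured_disjoint n (h : history n) :
  [disjoint red h & uncoloured h] /\ [disjoint blue h & uncoloured h].
Proof.
by split; rewrite disjoint_sym disjoints_subset /uncoloured setDE setCU;
  apply: subset_trans (subsetIr _ _) _; rewrite ?subsetIl ?subsetIr.
Qed.

(* When Alice is to move, the bound must survive whatever she plays next. *)
Lemma potential_bound n (h : history n) :
  legal_play p q h -> follows2 (@heaviest_strategy n) h ->
  if odd (size h) then (potential a b (red h) (blue h) <= n%:R * (1 + a) ^+ p : Prop)
  else forall F : graph n, F \subset uncoloured h -> (#|F| <= p)%N ->
    potential a b (red h :|: F) (blue h) <= n%:R * (1 + a) ^+ p.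
Proof.
elim/last_ind: h => [_ _|h M IH /legal_play_rcons[lh [_ sM cM]]] /=.
  (* Before Bob's first move, Alice has at most [p] edges at any vertex, whence the factor
     [(1 + a) ^+ p]. *)
  move=> F _ cF; rewrite /red /blue !big_ord0 set0U.
  rewrite -[n in n%:R]card_ord mulr_natl -sumr_const.
  apply: ler_sum => v _; rewrite /vertex_weight degree0 expr0 mulr1.
  by apply: ler_weXn2l (leq_trans (degree_le_card F v) cF); rewrite lerDl.
move=> /follows2_rcons[fh eM]; have {lh fh} := IH lh fh; rewrite size_rcons /=.
rewrite !history_unions_rcons uncoloured_rcons.
(* If Alice moved last, her move is an instance of the [F] in the induction hypothesis. If Bob did,
   his move and the coming [F] form one round. *)
case: odd eM cM => /= eM cM H; last by apply: H; rewrite // cM geq_minl.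
move=> F sF cF; apply: le_trans H; rewrite (eM isT) in sF *.
have [dr db] := uncoloured_disjoint h.
exact: potential_round.
Qed.

(** The size condition is squared so that [n.-1] need not be halved: a vertex with at least as much
    red as blue has [2 * red >= n - 1]. *)
Lemma red_lt_blue n (h : history n) v :
  1 < (1 + a) * (1 - b) ->
  (n%:R * (1 + a) ^+ p) ^+ 2 < ((1 + a) * (1 - b)) ^+ n.-1 ->
  legal_play p q h -> follows2 (@heaviest_strategy n) h -> uncoloured h = set0 ->
  (degree (red h) v < degree (blue h) v)%N.
Proof.
move=> g1 big lh fh u0; set g := (1 + a) * (1 - b) in g1 big *.
(* If the game ends with Alice to move, take her further move to be empty. *)
have bnd : potential a b (red h) (blue h) <= n%:R * (1 + a) ^+ p.
  have := potential_bound lh fh; case: odd => // /(_ set0).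
  by rewrite sub0set cards0 setU0; apply.
have {bnd} wb : vertex_weight a b (red h) (blue h) v <= n%:R * (1 + a) ^+ p.
  apply: le_trans bnd; rewrite /potential (bigD1 v) //= lerDl.
  by apply: sumr_ge0 => u _; apply: vertex_weight_ge0.
rewrite ltnNge; apply/negP => le_br.
(* Since blue is at most red here, raising the exponent of [1 - b] to the red degree can only shrink
   the weight. *)
have gw : g ^+ degree (red h) v <= vertex_weight a b (red h) (blue h) v.
  rewrite /g exprMn /vertex_weight; apply: ler_wpM2l; first exact: exprn_ge0.
  by apply: ler_wiXn2l => //; rewrite gerBl.
have n1 : (n.-1 <= degree (red h) v * 2)%N.
  apply: leq_trans (degree_complete_ge v) _.
  by rewrite (degree_final v lh u0); lia.
have := ler_weXn2l (ltW g1) n1; apply/negP; rewrite -ltNge.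
apply: le_lt_trans big; rewrite exprM; apply: lerXn2r.
- by rewrite nnegrE exprn_ge0 // mulr_ge0.
- by rewrite nnegrE mulr_ge0 ?ler0n ?exprn_ge0.
- exact: le_trans gw wb.
Qed.

End Weights.

(* With [b = a / (1 + 2a)] one has [(1 + a) * (1 - b) = (1 + a)^2 / (1 + 2a) > 1],
   and the balance condition reduces to [p * (1 + a)^(p + q + 2) <= q]. *)
Lemma weight_parameters p q : (p < q)%N -> exists a b : R,
  [/\ 0 <= a, 0 <= b <= 1, 1 < (1 + a) * (1 - b) &
      p%:R * (a * (1 + a) ^+ p) <= q%:R * (b * (1 - b) ^+ q)].
Proof.
move=> ltpq; pose k := (p + q + 2)%N.
have q0 : 0 < q%:R :> R by rewrite ltr0n; lia.
have k2 : 2 <= k%:R :> R by rewrite ler_nat /k; lia.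
have q1 : 1 <= q%:R :> R by rewrite ler1n; lia.
(* This value gives [q * (1 - k * a) = q - 1], which is at least [p]. *)
pose a : R := (q%:R * k%:R)^-1.
have qk0 : 0 < q%:R * k%:R :> R by nra.
have a0 : 0 < a by rewrite invr_gt0.
have aqk : q%:R * k%:R * a = 1 by rewrite mulfV // gt_eqF.
have a1 : a <= 1 by nra.
have d0 : 0 < 1 + 2 * a by lra.
pose b := a / (1 + 2 * a).
have bE : b * (1 + 2 * a) = a by rewrite /b divfK // gt_eqF.
have b0 : 0 < b by rewrite divr_gt0.
have b1 : b <= 1 by nra.
have cE : (1 - b) * (1 + 2 * a) = 1 + a by lra.
have c1 : 1 <= (1 - b) * (1 + a).
  have: (1 + 2 * a) * 1 <= (1 + 2 * a) * ((1 - b) * (1 + a)) by nra.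
  by rewrite ler_pM2l.
have g1 : 1 < (1 + a) * (1 - b).
  rewrite mulrC -(ltr_pM2l d0) mulr1 mulrA [_ * (1 - b)]mulrC cE; nra.
exists a, b; split=> //; [lra|lra|].
have e1 : 1 <= (1 - b) ^+ q * (1 + a) ^+ q by rewrite -exprMn exprn_ege1.
(* By Bernoulli [1 - k * a <= (1 - a) ^+ k], and [(1 - a) * (1 + a) <= 1]; hence
   [(1 - k * a) * (1 + a) ^+ k <= 1]. *)
have pk : p%:R * (1 + a) ^+ k <= q%:R.
  have B : 1 - k%:R * a <= (1 - a) ^+ k.
    by have := @bernoulli_ge (- a) k; rewrite mulrN; apply; lra.
  have P0 : 0 <= (1 + a) ^+ k by apply: exprn_ge0; lra.
  have S : (1 - a) ^+ k * (1 + a) ^+ k <= 1.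
    by rewrite -exprMn exprn_ile1 //; nra.
  have pq : p%:R <= q%:R * (1 - k%:R * a).
    have -> : q%:R * (1 - k%:R * a) = q%:R - 1 by rewrite mulrBr mulr1 mulrA aqk.
    by rewrite lerBrDr natr1 ler_nat.
  apply: le_trans (ler_wpM2r P0 pq) _; rewrite -mulrA -[leRHS]mulr1.
  by rewrite ler_wpM2l ?ler0n //; apply: le_trans S; rewrite ler_wpM2r.
have Q0 : 0 < (1 + a) ^+ q by apply: exprn_gt0; lra.
have P0 : 0 <= (1 + a) ^+ p by apply: exprn_ge0; lra.
(* This factor clears the denominator of [b] and, by [e1], absorbs [(1 - b) ^+ q]. The two spare
   factors in [k] cover [1 + 2 * a <= (1 + a) ^+ 2]. *)
rewrite -(ler_pM2r (mulr_gt0 d0 Q0)).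
apply: (@le_trans _ _ (q%:R * a)); last first.
  have -> : q%:R * (b * (1 - b) ^+ q) * ((1 + 2 * a) * (1 + a) ^+ q)
    = q%:R * (b * (1 + 2 * a)) * ((1 - b) ^+ q * (1 + a) ^+ q) by ring.
  by rewrite bE ler_peMr // mulr_ge0 ?ler0n // ltW.
apply: le_trans (ler_wpM2r (ltW a0) pk).
rewrite /k !exprD [leLHS](_ : _ =
  p%:R * ((1 + a) ^+ p * (1 + a) ^+ q * (1 + 2 * a)) * a); last by ring.
rewrite ler_wpM2r ?(ltW a0) // ler_wpM2l ?ler0n // ler_wpM2l //; last by nra.
by rewrite mulr_ge0 // ltW.
Qed.

End Potential.

(** * Large [n] and the conclusion *)

(** With [k] about [n / 3], the cube of Bernoulli's bound [g ^+ k >= 1 + k * e] is cubic in [n] and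
    overtakes the square. *)
Lemma expr_beats_square (R : archiRealFieldType) (g c : R) : 1 < g ->
  exists N, forall n, (N <= n)%N -> (n%:R * c) ^+ 2 < g ^+ n.-1.
Proof.
move=> g1; pose e := g - 1; have e0 : 0 < e by rewrite subr_gt0.
have e30 : 0 < e ^+ 3 by rewrite exprn_gt0.
(* The 36 is the square of the 6 in [n <= 6 * k], proved below. *)
pose C := 36 * c ^+ 2; have C0 : 0 <= C by rewrite mulr_ge0 ?sqr_ge0.
have CE : C / e ^+ 3 * e ^+ 3 = C by rewrite divfK // gt_eqF.
exists (3 * (Num.bound (C / e ^+ 3)).+2)%N => n leN.
pose k := (n.-1 %/ 3)%N.
have bk : (Num.bound (C / e ^+ 3) < k)%N by rewrite /k; lia.
have ltk : C / e ^+ 3 < k%:R.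
  apply: le_lt_trans (ltW (archi_boundP _)) _; last by rewrite ltr_nat.
  by rewrite divr_ge0 // ltW.
have nk : n%:R <= 6 * k%:R :> R by rewrite -natrM ler_nat /k; lia.
have k0 : 0 < k%:R :> R by rewrite ltr0n; lia.
have -> : (n%:R * c) ^+ 2 = n%:R ^+ 2 * c ^+ 2 by rewrite exprMn.
have le1 : n%:R ^+ 2 * c ^+ 2 <= C * k%:R ^+ 2.
  have n2 : n%:R ^+ 2 <= (6 * k%:R) ^+ 2 :> R.
    by rewrite lerXn2r ?nnegrE ?ler0n // mulr_ge0 // ler0n.
  by apply: le_trans (ler_wpM2r (sqr_ge0 c) n2) _; rewrite /C; lra.
apply: le_lt_trans le1 _; apply: (@lt_le_trans _ _ ((k%:R * e) ^+ 3)).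
  have -> : (k%:R * e) ^+ 3 = k%:R ^+ 2 * (k%:R * e ^+ 3) by ring.
  rewrite mulrC ltr_pM2l ?exprn_gt0 // -CE.
  by rewrite ltr_pM2r.
apply: (@le_trans _ _ (g ^+ (k * 3))); last by rewrite ler_weXn2l ?(ltW g1) // /k; lia.
have ke0 : 0 <= k%:R * e by rewrite mulr_ge0 ?ler0n // ltW.
rewrite exprM lerXn2r ?nnegrE //; first by rewrite exprn_ge0 //; lra.
have := @bernoulli_ge R e k; rewrite /e addrCA subrr addr0 -/e; lra.
Qed.

Local Close Scope ring_scope.

Theorem theorem3p1 (p q : nat) (hpq : p < q) :
  exists N : nat, forall n : nat, N <= n ->
    player2_wins p q (@max_degree n) /\ player2_wins p q (@captured n).
Proof.
have [a [b [a0 /andP[b0 b1] g1 bal]]] := weight_parameters rat hpq.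
have [N HN] := expr_beats_square ((1 + a) ^+ p)%R g1.
(* The successor excludes [n = 0], where both scores are 0 and Bob cannot win. *)
exists N.+1 => n ltN; have n0 : 0 < n by apply: leq_ltn_trans ltN.
have q0 : 0 < q by apply: leq_ltn_trans hpq.
have lt h v := @red_lt_blue _ p q a b a0 b0 b1 q0 bal n h v g1 (HN n (ltnW ltN)).
split; exists (@heaviest_strategy _ q a b n); split; try exact: heaviest_strategy_legal.
  move=> h lh fh u0; apply: max_degree_lt => // v; exact: lt.
move=> h lh fh u0; apply: captured_lt => // v; first exact: lt.
exact: degree_final lh u0.
Qed.
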